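(* For $n^2\ll e\ll n^3$ we have $\mathrm{un}_4(n,e)\lesssim \min\{(e/n^2)^{3/4},(e/n)^{1/3}\}$. That is, there are absolute constants $C_0,c_0,D>0$ such that for all sufficiently large $n$ and all $e$ with $C_0n^2\le e\le c_0n^3$, $\mathrm{un}_4(n,e)\le D\min\{(e/n^2)^{3/4},(e/n)^{1/3}\}$.
   Context: A $4$-graph is a $4$-uniform hypergraph. A $4$-graph $\mathcal{H}$ is $(n,e)$-unavoidable if every $4$-graph on $n$ vertices with $e$ edges contains a copy of $\mathcal{H}$; $\mathrm{un}_4(n,e)$ is the maximum number of edges of an $(n,e)$-unavoidable $4$-graph. *)

(* Defs.v *)
From mathcomp Require Import all_boot all_order all_algebra.
From mathcomp Require Import all_classical all_reals exp.

Set Implicit Arguments.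
Unset Strict Implicit.
Unset Printing Implicit Defensive.

Local Open Scope nat_scope.

Record kgraph (k : nat) := KGraph {
  vertex : finType;
  edges : {set {set vertex}};
  edges_uniform : forall A : {set vertex}, A \in edges -> #|A| = k }.

(* Copies are subgraphs in the usual (not necessarily induced) sense. *)
Definition contains_copy (k : nat) (G H : kgraph k) : Prop :=
  exists f : vertex H -> vertex G,
    injective f /\
    forall A : {set vertex H}, A \in edges H -> f @: A \in edges G.

Definition unavoidable (k n e : nat) (H : kgraph k) : Prop :=
  forall G : kgraph k,
    #|vertex G| = n -> #|edges G| = e -> contains_copy G H.

Definition is_max_unavoidable (k n e m : nat) : Prop :=
  (exists2 H : kgraph k, unavoidable n e H & #|edges H| = m) /\
  (forall H : kgraph k, unavoidable n e H -> #|edges H| <= m).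

(* The default value 0 is used only if there is no maximum, which forces
   'C(n, k) < e (see [unP]): no k-graph on n vertices has e edges then, so every
   k-graph is vacuously (n,e)-unavoidable. *)
Definition un (k n e : nat) : nat :=
  xget 0 [set m | is_max_unavoidable k n e m]%classic.

Lemma kgraph_exists (k n e : nat) : e <= 'C(n, k) ->
  exists G : kgraph k, #|vertex G| = n /\ #|edges G| = e.
Proof.
move=> le_e.
pose K := [set A : {set 'I_n} | #|A| == k].
have cK : #|K| = 'C(n, k) by rewrite card_draws card_ord.
pose E := [set A in take e (enum K)].
have EK A : A \in E -> #|A| = k.
  by rewrite inE => /mem_take; rewrite mem_enum inE => /eqP.
exists (KGraph EK) => /=; split; first by rewrite card_ord.
rewrite /E cardsE; have /card_uniqP-> : uniq (take e (enum K)).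
  by rewrite take_uniq // enum_uniq.
by rewrite size_takel // -cardE cK.
Qed.

Lemma unavoidable_leq (k n e : nat) (H : kgraph k) :
  e <= 'C(n, k) -> unavoidable n e H -> #|edges H| <= e.
Proof.
move=> /kgraph_exists[G [Gn Ge]] /(_ G Gn Ge)[f [f_inj fE]].
rewrite -Ge -(card_imset (mem (edges H)) (imset_inj f_inj)).
by apply/subset_leq_card/fintype.subsetP => _ /imsetP[A AH ->]; exact: fE.
Qed.

Lemma unP (k n e : nat) : e <= 'C(n, k) -> is_max_unavoidable k n e (un k n e).
Proof.
move=> le_e.
pose P m := `[< exists2 H : kgraph k, unavoidable n e H & #|edges H| = m >].
have exP : exists m, P m.
  have E0 (A : {set void}) : A \in (finset.set0 : {set {set void}}) -> #|A| = k.
    by rewrite finset.in_set0.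
  exists 0; apply/asboolP; exists (KGraph E0); last by rewrite /= cards0.
  by move=> G _ _; exists (of_void _); split=> [[]|A] //=; rewrite finset.in_set0.
have ubP m : P m -> m <= e.
  by move=> /asboolP[H Hun <-]; exact: unavoidable_leq Hun.
suff: exists m, is_max_unavoidable k n e m.
  by move=> [m Hm]; rewrite /un; case: xgetP => [x _|/(_ m)].
case: (ex_maxnP exP ubP) => m /asboolP Pm maxm; exists m; split=> // H Hun.
by apply: maxm; apply/asboolP; exists H.
Qed.

(* Main.v *)
Require Import Defs.
From mathcomp Require Import all_boot all_order all_algebra all_field.
From mathcomp Require Import zify ring.

Set Implicit Arguments.
Unset Strict Implicit.
Unset Printing Implicit Defensive.

(* Let H be (n,e)-unavoidable. Embedding H into various hosts with at least e
   edges restricts it more and more. As e is at most c n^3, the full star and the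
   4-partite system {x0 + x1 + x2 + x3 = 0} show that all edges of H share a
   vertex v and that two edges never share three vertices; a random host shows
   that H is locally sparse: every nonempty subfamily of its edges has fewer
   members than vertices, and by a constant factor fewer once e^5 <= n^14.

   The host made of disjoint cliques of order (e/n)^(1/3) bounds the number of
   vertices, hence of edges, of H; this is the second term of the minimum. The
   terms coincide at e^5 = n^14, so the first one matters only when
   e^5 <= n^14. Then write e = r^4 n^2 up to constants. Three more hosts are used.
   Sets with two vertices in a set of order r^2 give a set W of order r^2, avoiding
   v, that meets all edges. Collinear quadruples in a grid over a finite field give
   pair degrees at most r^2. Finally take disjoint stars with r^3 centres and r
   leaves each, and all 4-sets made of an edge of a star and two vertices outside
   the stars. If v is a centre, H is covered by r pairs at v; if v is a leaf, by
   one pair; otherwise each edge of H is determined by its leaf, so that at most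
   r |W| edges meet W in a star, and the others, which meet W outside of the stars,
   have all but r^2 + r^3 of their vertices among their leaves: sparsity bounds
   their number. In all cases H has O(r^3) edges. *)

(** * Copies in small hosts and in 4-partite hosts *)

Lemma injection_of_card (S T : finType) :
  #|S| <= #|T| -> exists f : S -> T, injective f.
Proof.
move=> le_ST; exists (fun x => enum_val (widen_ord le_ST (enum_rank x))).
move=> x y /enum_val_inj /(congr1 val) /= /val_inj; exact: enum_rank_inj.
Qed.

(** A host may have too few vertices and too many edges: surplus edges are discarded and isolated
    vertices added. Isolated vertices of [H] may land among the added ones, hence injectivity on the
    cover only. *)
Lemma copy_in_host (n e : nat) (H : kgraph 4) (T : finType)
    (E : {set {set T}}) :
  unavoidable n e H -> #|T| <= n -> 0 < e <= #|E| ->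
  (forall A, A \in E -> #|A| = 4) ->
  exists f : vertex H -> T,
    {in cover (edges H) &, injective f} /\
    (forall A, A \in edges H -> f @: A \in E).
Proof.
move=> unH leTn /andP[e_gt0 leE] E4.
have [t0 _] : exists t : T, true.
  have /card_gt0P[A AE] : 0 < #|E| by exact: leq_trans leE.
  have /card_gt0P[t _] : 0 < #|A| by rewrite (E4 _ AE).
  by exists t.
pose E' := [set A in take e (enum E)].
have E'E A : A \in E' -> A \in E by rewrite inE => /mem_take; rewrite mem_enum.
have cE' : #|E'| = e.
  rewrite cardsE; have /card_uniqP-> : uniq (take e (enum E)).
    by rewrite take_uniq // enum_uniq.
  by rewrite size_takel // -cardE.
pose U : finType := (T + 'I_(n - #|T|))%type.
have inl_inj : injective (@inl T 'I_(n - #|T|)) by move=> x y [].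
pose EU := [set (@inl T 'I_(n - #|T|)) @: (A : {set T}) | A in E'].
have EU4 (A : {set U}) : A \in EU -> #|A| = 4.
  by move=> /imsetP[B /E'E BE ->]; rewrite card_imset // E4.
have [||f [f_inj fE]] := unH (KGraph EU4).
- by rewrite /= card_sum card_ord subnKC.
- by rewrite /= card_imset //; exact: imset_inj.
(* The default [t0] is taken only at vertices that lie in no edge of [H]. *)
pose g x := if f x is inl t then t else t0.
have gP A x : A \in edges H -> x \in A -> f x = inl (g x).
  move=> AH xA; have /imsetP[B _ fAB] := fE A AH.
  have : f x \in f @: A by exact: imset_f.
  by rewrite fAB => /imsetP[t _ fxt]; rewrite /g fxt.
exists g; split=> [x y /bigcupP[A AH xA] /bigcupP[B BH yB] gxy|A AH].
  by apply: f_inj; rewrite (gP A) // (gP B) // gxy.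
have /imsetP[B BE' fAB] := fE A AH.
suff -> : g @: A = B by exact: E'E.
apply: (imset_inj inl_inj); rewrite -fAB -imset_comp.
by apply: eq_in_imset => x xA /=; rewrite (gP A).
Qed.

(* [c] and [g] are the two coordinates of an embedding into 'I_4 * Q, and
   [a A i] is the vertex of colour [i] of the edge [A]. *)
Definition partite_embedding (V Q P : finType) (X : {set {set V}})
    (phi : P -> 'I_4 -> Q) (c : V -> 'I_4) (g : V -> Q)
    (a : {set V} -> 'I_4 -> V) : Prop :=
  [/\ {in cover X &, forall x y, c x = c y -> g x = g y -> x = y},
      forall A, A \in X -> forall i, a A i \in A,
      forall A, A \in X -> forall x, x \in A -> x = a A (c x),
      forall A, A \in X -> forall i, c (a A i) = i &
      forall A, A \in X -> exists p, forall i, g (a A i) = phi p i].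

(** The host has vertex set ['I_4 * Q], and its edges are the graphs of the maps [phi p]; these are
    distinct, so there are [#|P|] of them. Every explicit host below is given by a choice of [Q],
    [P] and [phi]. *)
Lemma partite_copy (n e : nat) (H : kgraph 4) (Q P : finType)
    (phi : P -> 'I_4 -> Q) :
  vertex H -> unavoidable n e H -> 4 * #|Q| <= n -> 0 < e <= #|P| ->
  (forall p p', phi p =1 phi p' -> p = p') ->
  exists c g a, partite_embedding (edges H) phi c g a.
Proof.
move=> v0 unH leQ leP phi_inj.
pose T : finType := ('I_4 * Q)%type.
pose gr p : {set T} := [set (i, phi p i) | i : 'I_4].
have grP p i q : ((i, q) \in gr p) = (q == phi p i).
  apply/imsetP/eqP => [[j _ [-> ->]] //|->]; by exists i.
have gr_inj : injective gr.
  move=> p p' eq_gr; apply: phi_inj => i; apply/eqP.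
  by rewrite -grP -eq_gr grP.
pose E := [set gr p | p : P].
have [||| f [f_inj fE]] := copy_in_host (E := E) unH.
- by rewrite card_prod card_ord.
- by rewrite card_imset.
- move=> _ /imsetP[p _ ->]; rewrite card_imset ?card_ord //.
  by move=> i j [].
have ex_a (A : {set vertex H}) : exists a : 'I_4 -> vertex H, A \in edges H ->
    [/\ forall i, a i \in A, forall x, x \in A -> x = a (f x).1,
        forall i, (f (a i)).1 = i &
        exists p, forall i, (f (a i)).2 = phi p i].
  have [AH|_] := boolP (A \in edges H); last by exists (fun=> v0).
  have /imsetP[p _ fAp] := fE A AH.
  have /fin_all_exists[a aP] : forall i, exists x, x \in A /\ f x = (i, phi p i).
    move=> i; have : (i, phi p i) \in f @: A by rewrite fAp grP.
    by case/imsetP => x xA ->; exists x.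
  exists a => _; split=> [i|x xA|i|]; first by case: (aP i).
  - have : f x \in f @: A by exact: imset_f.
    rewrite fAp; case fx: (f x) => [i q]; rewrite grP => /eqP eq_q /=.
    apply: f_inj; [by apply/bigcupP; exists A| |].
      by apply/bigcupP; exists A => //; case: (aP i).
    by case: (aP i) => _ ->; rewrite fx eq_q.
  - by case: (aP i) => _ ->.
  - by exists p => i; case: (aP i) => _ ->.
have /fin_all_exists[a aP] := ex_a.
exists (fun x => (f x).1), (fun x => (f x).2), a; split.
- move=> x y xX yX eq1 eq2; apply: f_inj => //.
  by rewrite [f x]surjective_pairing eq1 eq2 -surjective_pairing.
- by move=> A /aP[].
- by move=> A /aP[].
- by move=> A /aP[].
- by move=> A /aP[].
Qed.

Definition quad (Q : Type) (x0 x1 x2 x3 : Q) (i : 'I_4) : Q :=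
  nth x0 [:: x0; x1; x2; x3] i.

Definition color0 : 'I_4 := @Ordinal 4 0 isT.
Definition color1 : 'I_4 := @Ordinal 4 1 isT.
Definition color2 : 'I_4 := @Ordinal 4 2 isT.
Definition color3 : 'I_4 := @Ordinal 4 3 isT.

Lemma ord4P (P : 'I_4 -> Prop) :
  P color0 -> P color1 -> P color2 -> P color3 -> forall i, P i.
Proof.
move=> P0 P1 P2 P3 [[|[|[|[|k]]]] lt_k] //.
- by rewrite (_ : Ordinal _ = color0) //; exact: val_inj.
- by rewrite (_ : Ordinal _ = color1) //; exact: val_inj.
- by rewrite (_ : Ordinal _ = color2) //; exact: val_inj.
- by rewrite (_ : Ordinal _ = color3) //; exact: val_inj.
Qed.

(** * Counting tools and basic properties of embeddings *)

Lemma card_le_inj (S T : finType) (X : {set S}) (Y : {set T}) (f : S -> T) :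
  {in X &, injective f} -> (forall x, x \in X -> f x \in Y) -> #|X| <= #|Y|.
Proof.
move=> f_inj fXY; rewrite -(card_in_imset f_inj).
by apply/subset_leq_card/subsetP => _ /imsetP[x /fXY fx ->].
Qed.

(** Weaker than the usual linearity of hypergraphs: two edges may share two vertices. It is the link
    of each vertex that is linear in the usual sense. *)
Definition linear_family (V : finType) (X : {set {set V}}) : Prop :=
  forall (A B : {set V}) v w u, A \in X -> B \in X -> uniq [:: v; w; u] ->
    v \in A -> w \in A -> u \in A -> v \in B -> w \in B -> u \in B -> A = B.

Definition pair_degree (V : finType) (X : {set {set V}}) (v w : V) : nat :=
  #|[set A in X | (v \in A) && (w \in A)]|.

Lemma leq_bigcup_card (S T : finType) (X : {set T}) (Y : {set S})
    (P : S -> T -> bool) (d : nat) :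
  (forall A, A \in X -> exists2 w, w \in Y & P w A) ->
  (forall w, w \in Y -> #|[set A in X | P w A]| <= d) -> #|X| <= #|Y| * d.
Proof.
move=> exw degw.
apply: (@leq_trans #|\bigcup_(w in Y) [set A in X | P w A]|).
  apply/subset_leq_card/subsetP => A AX; have [w wY PwA] := exw A AX.
  by apply/bigcupP; exists w => //; rewrite inE AX.
rewrite -sum_nat_const; apply: (@leq_trans (\sum_(w in Y) #|[set A in X | P w A]|));
  last exact: leq_sum.
by elim/big_rec2: _ => [|w Z k _ leZ]; rewrite ?cards0 // cardsU; lia.
Qed.

Lemma emb_cover (V Q P : finType) (X : {set {set V}})
    (phi : P -> 'I_4 -> Q) (c : V -> 'I_4) (g : V -> Q)
    (a : {set V} -> 'I_4 -> V) A i :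
  partite_embedding X phi c g a -> A \in X -> a A i \in cover X.
Proof.
by move=> [_ aA _ _ _] AX; apply/bigcupP; exists A => //; exact: aA. Qed.

Lemma emb_vertex (V Q P : finType) (X : {set {set V}})
    (phi : P -> 'I_4 -> Q) (c : V -> 'I_4) (g : V -> Q)
    (a : {set V} -> 'I_4 -> V) A x i :
  partite_embedding X phi c g a -> A \in X -> x \in cover X -> c x = i ->
  g x = g (a A i) -> x = a A i.
Proof.
move=> emb AX xX cx; have [inj _ _ ca _] := emb.
by apply: inj; rewrite ?ca //; exact: emb_cover emb _.
Qed.

Lemma emb_edge_eq (V Q P : finType) (X : {set {set V}})
    (phi : P -> 'I_4 -> Q) (c : V -> 'I_4) (g : V -> Q)
    (a : {set V} -> 'I_4 -> V) A B :
  partite_embedding X phi c g a -> A \in X -> B \in X -> a A =1 a B -> A = B.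
Proof.
move=> [_ aA xA _ _] AX BX eq_a.
apply/setP => x; apply/idP/idP => [xA'|xB].
  by rewrite (xA _ AX _ xA') eq_a aA.
by rewrite (xA _ BX _ xB) -eq_a aA.
Qed.

Lemma emb_color_neq (V Q P : finType) (X : {set {set V}})
    (phi : P -> 'I_4 -> Q) (c : V -> 'I_4) (g : V -> Q)
    (a : {set V} -> 'I_4 -> V) A x y :
  partite_embedding X phi c g a -> A \in X -> x \in A -> y \in A -> x != y ->
  c x != c y.
Proof.
move=> [_ _ xA _ _] AX xAX yAX; apply: contra_neq => eq_c.
by rewrite (xA _ AX _ xAX) eq_c -xA.
Qed.


(** * Explicit hosts: star, linear system, disjoint blocks, collinear quadruples *)

(** All host edges share the vertex [ord0] of colour 0, and only one vertex of [H] can be mapped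
    there. *)
Lemma unavoidable_star (n e m : nat) (H : kgraph 4) :
  vertex H -> unavoidable n e H -> 4 * m <= n -> 0 < e <= m ^ 3 ->
  exists v : vertex H, forall A, A \in edges H -> v \in A.
Proof.
move=> v0 unH lemn /andP[e_gt0 lee].
case: m => [|m] in lemn lee *; first by rewrite leqn0 in lee; lia.
have [||| c [g [a emb]]] := partite_copy (Q := 'I_m.+1)
    (P := ('I_m.+1 * 'I_m.+1 * 'I_m.+1)%type) (phi := fun p =>
      quad ord0 p.1.1 p.1.2 p.2) (e := e) v0 unH.
- by rewrite card_ord.
- by rewrite !card_prod !card_ord e_gt0 (leq_trans lee) // !expnS expn0 muln1 mulnA.
- move=> [[x y] z] [[x' y'] z'] eq_p.
  by move: (eq_p color1) (eq_p color2) (eq_p color3); rewrite /quad /= => -> -> ->.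
have [X0|[A0 A0X]] := set_0Vmem (edges H).
  by exists v0 => A; rewrite X0 inE.
exists (a A0 color0) => A AX.
have [_ aA _ ca gp] := emb.
rewrite (emb_vertex emb AX (emb_cover color0 emb A0X) (ca _ A0X color0));
  first exact: aA.
have [p gpA] := gp A AX; have [p0 gpA0] := gp A0 A0X.
by rewrite gpA gpA0.
Qed.

(** Three coordinates of a solution of x0 + x1 + x2 + x3 = 0 in a cyclic group determine the
    fourth. *)
Lemma unavoidable_linear (n e m : nat) (H : kgraph 4) :
  vertex H -> unavoidable n e H -> 4 * m <= n -> 0 < e <= m ^ 3 ->
  linear_family (edges H).
Proof.
move=> v0 unH lemn /andP[e_gt0 lee].
case: m => [|m] in lemn lee *; first by rewrite leqn0 in lee; lia.
have [||| c [g [a emb]]] := partite_copy (Q := 'I_m.+1)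
    (P := ('I_m.+1 * 'I_m.+1 * 'I_m.+1)%type) (phi := fun p =>
      quad p.1.1 p.1.2 p.2 (- (p.1.1 + p.1.2 + p.2))%R) (e := e) v0 unH.
- by rewrite card_ord.
- by rewrite !card_prod !card_ord e_gt0 (leq_trans lee) // !expnS expn0 muln1 mulnA.
- move=> [[x y] z] [[x' y'] z'] eq_p.
  by move: (eq_p color0) (eq_p color1) (eq_p color2); rewrite /quad /= => -> -> ->.
have [_ aA xA ca gp] := emb.
have sum0 A : A \in edges H -> (\sum_i g (a A i) = 0)%R.
  move=> AX; have [p gpA] := gp A AX; under eq_bigr do rewrite gpA.
  rewrite !big_ord_recl big_ord0 /quad /= /bump /=.
  by rewrite GRing.addr0 !GRing.addrA GRing.addrN.
move=> A B v w u AX BX uvw vA wA uA vB wB uB.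
(* Vertices of one edge have distinct colours; [j] is the colour left over by [v], [w], [u]. *)
have /cards1P[j Dj] : #|~: [set c v; c w; c u]| == 1.
  rewrite cardsCs setCK card_ord.
  suff -> : #|[set c v; c w; c u]| = 3 by [].
  move: uvw; rewrite /= !inE negb_or andbT => /andP[/andP[nvw nvu] nwu].
  rewrite setUC cardsU1 cards2 !inE negb_or.
  by rewrite ![c u == _]eq_sym !(emb_color_neq emb AX).
have eq_a i : i != j -> a A i = a B i.
  move=> nij; have: i \notin ~: [set c v; c w; c u] by rewrite Dj inE.
  rewrite inE negbK !inE -!orbA => /or3P[] /eqP ->;
    by rewrite -(xA _ AX) // -(xA _ BX).
apply: (emb_edge_eq emb) => // i; have [->|] := eqVneq i j; last exact: eq_a.
apply: (emb_vertex emb BX (emb_cover j emb AX)); first exact: ca.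
have := etrans (sum0 _ AX) (esym (sum0 _ BX)).
rewrite (bigD1 j) //= [RHS](bigD1 j) //=.
rewrite (eq_bigr (fun i => g (a B i))) => [|k /eq_a -> //].
by move/GRing.addIr.
Qed.

(** The host consists of [s] disjoint complete 4-partite blocks with parts of size [r]. All edges
    contain [v], so they lie in a single block, which has [4 * r] vertices. *)
Lemma unavoidable_connected (n e r s : nat) (H : kgraph 4) (v : vertex H) :
  unavoidable n e H -> (forall A, A \in edges H -> v \in A) ->
  4 * (r * s) <= n -> 0 < e <= s * r ^ 4 -> #|cover (edges H)| <= 4 * r.
Proof.
move=> unH vH lemn lee.
have [||| c [g [a emb]]] := partite_copy (Q := ('I_r * 'I_s)%type)
    (P := ('I_s * {ffun 'I_4 -> 'I_r})%type) (phi := fun p i =>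
      (p.2 i, p.1)) (e := e) v unH.
- by rewrite card_prod !card_ord.
- by rewrite card_prod card_ffun !card_ord.
- move=> [x p] [y q] eq_p; case: (eq_p color0) => _ /= ->; congr pair.
  by apply/ffunP => i; case: (eq_p i).
have [inj _ xA ca gp] := emb.
have -> : 4 * r = #|[set: 'I_4 * 'I_r]| by rewrite cardsT card_prod !card_ord.
apply: (card_le_inj (f := fun x => (c x, (g x).1))) => [x y xX yX []|//].
move=> eq_c eq_g; apply: inj => //.
suff gv z : z \in cover (edges H) -> (g z).2 = (g v).2.
  by rewrite [LHS]surjective_pairing eq_g gv // -(gv y) // -surjective_pairing.
move=> /bigcupP[A AX zA]; have [p gpA] := gp A AX.
by rewrite (xA _ AX _ zA) (xA _ AX _ (vH A AX)) !gpA.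
Qed.

(* The host lives on four copies of F x 'I_s, the second coordinate encoding an
   abscissa through [xi]; its edges are the collinear quadruples. *)
Lemma unavoidable_pair_degree (n e s : nat) (F : finFieldType) (H : kgraph 4)
    (v w : vertex H) :
  unavoidable n e H -> linear_family (edges H) -> 4 * (#|F| * s) <= n ->
  4 * s <= #|F| -> 0 < e <= #|F| ^ 2 * s ^ 4 -> v != w ->
  pair_degree (edges H) v w <= 4 * s.
Proof.
move=> unH lin lemn les lee nvw.
(* Different colours get different abscissae, so two vertices of an edge determine its line. *)
have [|xi xi_inj] := @injection_of_card ('I_4 * 'I_s)%type F.
  by rewrite card_prod !card_ord.
pose point (l : F * F) i t : F * 'I_s := (l.1 * xi (i, t) + l.2, t)%R.
have line_inj l l' i j t t' : i != j ->
    point l i t = point l' i t -> point l j t' = point l' j t' -> l = l'.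
  case: l l' => [x y] [x' y'] nij [/= E1] [/= E2].
  have /eqP: ((x - x') * (xi (i, t) - xi (j, t')) = 0)%R.
    transitivity ((x * xi (i, t) + y - (x' * xi (i, t) + y')) -
       (x * xi (j, t') + y - (x' * xi (j, t') + y')))%R; first by ring.
    by rewrite E1 E2; ring.
  rewrite GRing.mulf_eq0 !GRing.subr_eq0 => /orP[/eqP Ex|/eqP/xi_inj[]].
    by move: E1; rewrite Ex => /GRing.addrI ->.
  by move/eqP: nij.
have [||| c [g [a emb]]] := partite_copy (Q := (F * 'I_s)%type)
    (P := ((F * F) * {ffun 'I_4 -> 'I_s})%type) (phi := fun p i =>
      point p.1 i (p.2 i)) (e := e) v unH.
- by rewrite card_prod !card_ord.
- by rewrite !card_prod card_ffun !card_ord mulnn.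
- move=> [l p] [l' p'] eq_p; have eq_pp : p = p'.
    by apply/ffunP => i; case: (eq_p i).
  rewrite -eq_pp in eq_p *; congr pair.
  exact: (line_inj _ _ color0 color1 _ _ isT (eq_p color0) (eq_p color1)).
have [inj aA xA ca gp] := emb.
rewrite /pair_degree; set D := [set _ in _ | _].
have [-> |[A0]] := set_0Vmem D; first by rewrite cards0.
rewrite inE => /and3P[A0X vA0 wA0].
have [p0 gp0] := gp A0 A0X.
(* The images of [v] and [w] have distinct colours and fix the line: all edges through both lie on
   the line of [A0]. *)
have on_line A u : A \in D -> u \in A -> g u = point p0.1 (c u) (g u).2.
  rewrite inE => /and3P[AX vA wA] uA; have [p gpA] := gp A AX.
  have -> : p0.1 = p.1.
    have ncvw := emb_color_neq emb AX vA wA nvw.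
    have Ev := gpA (c v); have Ev0 := gp0 (c v).
    have Ew := gpA (c w); have Ew0 := gp0 (c w).
    rewrite -(xA _ AX) // in Ev; rewrite -(xA _ AX) // in Ew.
    rewrite -(xA _ A0X) // in Ev0; rewrite -(xA _ A0X) // in Ew0.
    have tv : p0.2 (c v) = p.2 (c v) by case: (etrans (esym Ev0) Ev).
    have tw : p0.2 (c w) = p.2 (c w) by case: (etrans (esym Ew0) Ew).
    apply: (line_inj _ _ _ _ (p.2 (c v)) (p.2 (c w)) ncvw).
      by rewrite -Ev -tv -Ev0.
    by rewrite -Ew -tw -Ew0.
  by rewrite (xA _ AX _ uA) gpA ca.
(* By linearity a third vertex [u A] determines [A]. On the fixed line it is determined by its
   colour and second coordinate, which leaves [4 * s] values. *)
have /fin_all_exists[u uP] (A : {set vertex H}) : exists u, A \in D ->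
    [/\ u \in A, u != v & u != w].
  have [AD|_] := boolP (A \in D); last by exists v.
  have /and3P[AX vA wA] : [&& A \in edges H, v \in A & w \in A].
    by rewrite inE in AD.
  have : 0 < #|A :\ v :\ w|.
    have := edges_uniform AX; rewrite (cardsD1 v) vA (cardsD1 w) !inE eq_sym nvw wA.
    by rewrite /= => E; lia.
  by move=> /card_gt0P[u]; rewrite !inE => /and3P[? ? ?]; exists u.
have -> : 4 * s = #|[set: 'I_4 * 'I_s]| by rewrite cardsT card_prod !card_ord.
apply: (card_le_inj (f := fun A => (c (u A), (g (u A)).2))) => [A B AD BD []|//].
move=> eq_c eq_g.
have [[uA uv uw] [uB _ _]] := (uP A AD, uP B BD).
have /and3P[AX vA wA] : [&& A \in edges H, v \in A & w \in A] by rewrite inE in AD.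
have /and3P[BX vB wB] : [&& B \in edges H, v \in B & w \in B] by rewrite inE in BD.
have eq_u : u A = u B.
  apply: inj => //; [by apply/bigcupP; exists A|by apply/bigcupP; exists B|].
  by rewrite (on_line A (u A)) // eq_c eq_g -(on_line B).
apply: (lin A B v w (u A)) => //; last by rewrite eq_u.
by rewrite /= !inE negb_or nvw ![_ == u A]eq_sym uv uw.
Qed.

(** * Random hosts and local sparsity *)

(** The ratio of the two binomials is the product of (e - i) / (M - i) over i < m, and each factor
    is at most e / M. *)
Lemma bin_sub_leq (M e m : nat) : m <= e <= M ->
  'C(M - m, e - m) * M ^ m <= 'C(M, e) * e ^ m.
Proof.
elim: m => [|m IHm]; first by rewrite !subn0 !expn0.
move=> /andP[lt_me leM].
have {IHm} := IHm ltac:(by rewrite ltnW).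
have /= := mul_bin_diag (M - m) (e - m).-1.
rewrite !prednK ?subn_gt0 // ?(leq_trans lt_me) // -!subnS => diag IH.
rewrite !expnS -(@leq_pmul2l (M - m)) ?subn_gt0 ?(leq_trans lt_me) //.
have -> : (M - m) * ('C(M - m.+1, e - m.+1) * (M * M ^ m))
       = ((e - m) * M) * ('C(M - m, e - m) * M ^ m).
  by rewrite mulnA diag; ring.
have -> : (M - m) * ('C(M, e) * (e * e ^ m))
       = ((M - m) * e) * ('C(M, e) * e ^ m) by ring.
apply: leq_mul => //; rewrite !mulnBl; nia.
Qed.

(* First-moment count: a uniformly random [e]-subset of the 4-sets of 'I_n
   contains a given family of [m] 4-sets with probability at most
   (e / 'C(n, 4)) ^ m. *)
Lemma unavoidable_sparse (n e : nat) (H : kgraph 4)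
    (Y : {set {set vertex H}}) :
  unavoidable n e H -> e <= 'C(n, 4) -> Y \subset edges H ->
  'C(n, 4) ^ #|Y| <= n ^ #|cover Y| * e ^ #|Y|.
Proof.
move=> unH leeM YX; set M := 'C(n, 4); set m := #|Y|; set w := #|cover Y|.
have lem : m <= e.
  by rewrite (leq_trans _ (unavoidable_leq leeM unH)) // subset_leq_card.
have [Y0|[A0 A0Y]] := set_0Vmem Y.
  by rewrite /m /w Y0 /cover big_set0 !cards0.
have m_gt0 : 0 < m by apply/card_gt0P; exists A0.
have [y0 _] : exists y : 'I_n, true.
  have : 0 < M by lia.
  by rewrite bin_gt0 => /(leq_trans (isT : 0 < 4)) n_gt0; exists (Ordinal n_gt0).
rewrite leqNgt; apply/negP => lt_M.
pose K := [set A : {set 'I_n} | #|A| == 4].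
have cK : #|K| = M by rewrite card_draws card_ord.
pose GG := [set G : {set {set 'I_n}} | G \subset K & #|G| == e].
have cGG : #|GG| = 'C(M, e) by rewrite cards_draws cK.
pose im (f : vertex H -> 'I_n) : {set {set 'I_n}} :=
  [set f @: (A : {set vertex H}) | A in Y].
(* Only the values on the cover of [Y] matter; the constant [y0] elsewhere leaves at most [n ^ w]
   maps. *)
pose FF := [set f : {ffun vertex H -> 'I_n} |
  (f \in pffun_on y0 (mem (cover Y)) predT) && (#|im f| == m)].
have cFF : #|FF| <= n ^ w.
  have -> : n ^ w = #|pffun_on y0 (mem (cover Y)) (@predT 'I_n)|.
    by rewrite card_pffun_on card_ord.
  by apply/subset_leq_card/subsetP => f; rewrite inE => /andP[].
(* Union bound: each member of [GG] contains a copy of [H], hence an image of [Y] with [m] members,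
   and such an image lies in at most ['C(M - m, e - m)] members of [GG]. *)
have : #|GG| <= #|FF| * 'C(M - m, e - m).
  apply: (leq_bigcup_card (P := fun (f : {ffun vertex H -> 'I_n})
    (G : {set {set 'I_n}}) => im f \subset G)).
    move=> G; rewrite inE => /andP[/subsetP GK /eqP cG].
    have GU A : A \in G -> #|A| = 4 by move=> /GK; rewrite inE => /eqP.
    have [| |f0 [f0_inj f0E]] := unH (KGraph GU) => //=; first exact: card_ord.
    pose f := [ffun x => if x \in cover Y then f0 x else y0].
    have imE : im f = [set f0 @: (A : {set vertex H}) | A in Y].
      apply: eq_in_imset => A AY; apply: eq_in_imset => x xA.
      by rewrite ffunE ifT //; apply/bigcupP; exists A.
    exists f.
      rewrite inE imE card_imset ?eqxx ?andbT; last exact: imset_inj.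
      apply/pffun_onP; split=> [|//].
      apply/subsetP => x; rewrite !inE ffunE; case: ifP => //.
      by rewrite eqxx.
    rewrite imE; apply/subsetP => _ /imsetP[A AY ->].
    by apply: f0E; exact: (subsetP YX).
  move=> f; rewrite inE => /andP[_ /eqP cim].
  set D := [set _ in _ | _].
  have [->|[G0]] := set_0Vmem D; first by rewrite cards0.
  rewrite !inE => /andP[/andP[G0K _] imG0].
  have imK := subset_trans imG0 G0K.
  have cKim : #|K :\: im f| = M - m by rewrite cardsD (setIidPr imK) cK cim.
  rewrite -cKim -cards_draws.
  apply: (card_le_inj (f := fun G => G :\: im f)) => [G1 G2|G]; rewrite !inE.
    move=> /andP[_ im1] /andP[_ im2] eqD.
    by rewrite -(setID G1 (im f)) -(setID G2 (im f)) eqD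
      (setIidPr im1) (setIidPr im2).
  move=> /andP[/andP[GK /eqP cG] imG].
  by rewrite setSD //= cardsD (setIidPr imG) cim cG.
rewrite cGG leqNgt => /negP[].
have M_gt0 : 0 < M ^ m by rewrite expn_gt0; lia.
rewrite -(ltn_pmul2r M_gt0).
have := bin_sub_leq (M := M) (e := e) (m := m) ltac:(by rewrite lem).
have C_gt0 : 0 < 'C(M, e) by rewrite bin_gt0.
move: lt_M cFF; move: (M ^ m) (e ^ m) (n ^ w) #|FF| 'C(M, e) 'C(M - m, e - m) C_gt0.
move=> a b c d p q p0 lt1 lt2 lt3.
apply: (@leq_ltn_trans (c * (p * b))); first by nia.
by have -> : c * (p * b) = p * (c * b) by [ring]; rewrite ltn_pmul2l.
Qed.

(** * Hosts with a small covering set, and hosts made of stars *)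

(** A partial inverse of the embedding, turning a bound on host positions into a bound on vertices
    of [H]. The default [v] is taken only at positions that no covered vertex occupies. *)
Definition vertex_at (V Q : finType) (X : {set {set V}}) (c : V -> 'I_4)
    (g : V -> Q) (v : V) (i : 'I_4) (q : Q) : V :=
  odflt v [pick w in cover X | (c w == i) && (g w == q)].

Lemma vertex_atE (V Q P : finType) (X : {set {set V}})
    (phi : P -> 'I_4 -> Q) (c : V -> 'I_4) (g : V -> Q)
    (a : {set V} -> 'I_4 -> V) v A i :
  partite_embedding X phi c g a -> A \in X ->
  a A i = vertex_at X c g v i (g (a A i)).
Proof.
move=> emb AX; rewrite /vertex_at; case: pickP => [w /and3P[wX /eqP cw /eqP gw]|].
  by rewrite (emb_vertex emb AX wX cw gw).
have [_ _ _ ca _] := emb.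
by move=> /(_ (a A i)); rewrite (emb_cover i emb AX) ca // !eqxx.
Qed.

(** Two colours, not one, are confined to [k] positions so that [W] can omit [v]: an edge whose
    vertex of colour 0 is [v] is still met in colour 1. *)
Lemma unavoidable_cover (n e k m : nat) (H : kgraph 4) (v : vertex H) :
  unavoidable n e H -> 4 * m <= n -> k <= m -> 0 < e <= k ^ 2 * m ^ 2 ->
  exists W : {set vertex H}, [/\ v \notin W, #|W| <= 2 * k &
    forall A, A \in edges H -> exists2 w, w \in W & w \in A].
Proof.
move=> unH lemn lekm lee.
have [||| c [g [a emb]]] := partite_copy (Q := 'I_m)
    (P := ('I_k * 'I_k * ('I_m * 'I_m))%type) (phi := fun p =>
      quad (widen_ord lekm p.1.1) (widen_ord lekm p.1.2) p.2.1 p.2.2)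
    (e := e) v unH.
- by rewrite card_ord.
- by rewrite !card_prod !card_ord !mulnn.
- move=> [[x y] [z t]] [[x' y'] [z' t']] eq_p.
  move: (eq_p color0) (eq_p color1) (eq_p color2) (eq_p color3); rewrite /quad /=.
  by move=> /(congr1 val)/= /val_inj -> /(congr1 val)/= /val_inj -> -> ->.
have [inj aA xA ca gp] := emb.
pose W i := [set vertex_at (edges H) c g v i (widen_ord lekm j) | j : 'I_k].
have cW i : #|W i| <= k by rewrite (leq_trans (leq_imset_card _ _)) // card_ord.
exists ((W color0 :|: W color1) :\ v); split; first by rewrite !inE eqxx.
  rewrite (leq_trans (subset_leq_card (subsetDl _ _))) //.
  by rewrite cardsU; have := cW color0; have := cW color1; lia.
move=> A AX; have [p gpA] := gp A AX.
have aW0 : a A color0 \in W color0.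
  by apply/imsetP; exists p.1.1 => //; rewrite {1}(vertex_atE v color0 emb AX) gpA.
have aW1 : a A color1 \in W color1.
  by apply/imsetP; exists p.1.2 => //; rewrite {1}(vertex_atE v color1 emb AX) gpA.
have [eqv|nv] := eqVneq (a A color0) v.
  exists (a A color1); last exact: aA.
  rewrite !inE aW1 orbT andbT -eqv; apply/eqP => /(congr1 c).
  by rewrite !ca.
by exists (a A color0); rewrite ?aA // !inE nv aW0.
Qed.

(* [x] is the number of stars and [y] the number of leaves of each; the star
   centres have colour 0 and the leaves colour 1. *)
Lemma unavoidable_stars (n e x y m d w : nat) (H : kgraph 4)
    (v : vertex H) (W : {set vertex H}) :
  unavoidable n e H -> 4 * m <= n -> x * y <= m ->
  0 < e <= x * y * m ^ 2 ->
  (forall A, A \in edges H -> v \in A) -> linear_family (edges H) ->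
  (forall u, v != u -> pair_degree (edges H) v u <= d) ->
  v \notin W -> #|W| <= w ->
  (forall A, A \in edges H -> exists2 u, u \in W & u \in A) ->
  (forall Y : {set {set vertex H}}, (Y \subset edges H) -> 0 < #|Y| ->
    11 * #|Y| <= 10 * #|cover Y|) ->
  #|edges H| <= y * d + w * y + 10 * (1 + w + x).
Proof.
move=> unH lemn lexy lee vH lin degv vW cW Wcov sparse.
have [|xi xi_inj] := @injection_of_card ('I_x * 'I_y)%type 'I_m.
  by rewrite card_prod !card_ord.
have y_gt0 : 0 < y.
  by case: y {lexy xi xi_inj} lee => //; rewrite muln0 mul0n leqn0; lia.
have [|ka ka_inj] := @injection_of_card 'I_x 'I_m.
  by rewrite !card_ord; nia.
set X := edges H in vH lin degv Wcov sparse *.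
have [||| c [g [a emb]]] := partite_copy (Q := 'I_m)
    (P := ('I_x * 'I_y * ('I_m * 'I_m))%type) (phi := fun p =>
      quad (ka p.1.1) (xi p.1) p.2.1 p.2.2) (e := e) v unH.
- by rewrite card_ord.
- by rewrite !card_prod !card_ord mulnn.
- move=> [ij [z t]] [ij' [z' t']] eq_p.
  move: (eq_p color1) (eq_p color2) (eq_p color3); rewrite /quad /=.
  by move=> /xi_inj -> -> ->.
rewrite -/X in emb.
have [inj aA xA ca gp] := emb.
pose vert := vertex_at X c g v.
have av A : A \in X -> a A (c v) = v by move=> AX; rewrite -(xA _ AX) // vH.
have anv A i : A \in X -> i != c v -> a A i != v.
  by move=> AX; apply: contra_neq => <-; rewrite ca.
have deg_le u : v != u -> #|[set A in X | u \in A]| <= d.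
  move=> nvu; apply: leq_trans (degv u nvu); apply/subset_leq_card/subsetP => A.
  by rewrite !inE => /andP[AX uA]; rewrite AX uA vH.
pose leaves i := [set vert color1 (xi (i, j)) | j : 'I_y].
have c_leaves i : #|leaves i| <= y.
  by rewrite (leq_trans (leq_imset_card _ _)) // card_ord.
have center A i : A \in X -> g (a A color0) = ka i -> a A color1 \in leaves i.
  move=> AX; have [p gpA] := gp A AX; rewrite gpA /quad /= => /ka_inj <-.
  apply/imsetP; exists p.1.2 => //; rewrite -surjective_pairing.
  by rewrite {1}(vertex_atE v color1 emb AX) gpA.
have [X0|[A0 A0X]] := set_0Vmem X; first by rewrite X0 cards0.
have [p0 gp0] := gp A0 A0X.
(* If [v] is a centre, every edge contains one of the at most [y] leaves of its star. *)
have [cv0|ncv0] := eqVneq (c v) color0.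
  suff : #|X| <= #|leaves p0.1.1 :\ v| * d.
    have := subset_leq_card (subsetDl (leaves p0.1.1) [set v]).
    by have := c_leaves p0.1.1; nia.
  apply: (leq_bigcup_card (P := fun u (A : {set vertex H}) => u \in A)) => [A AX|u].
    exists (a A color1); last exact: aA.
    rewrite !inE anv ?cv0 //=; apply: center => //.
    by rewrite -cv0 av // -(av A0) // cv0 gp0.
  by rewrite !inE => /andP[nuv _]; rewrite deg_le // eq_sym.
(* If [v] is a leaf, its centre [u] is determined, and all edges contain both. *)
have [cv1|ncv1] := eqVneq (c v) color1.
  suff : #|X| <= d by nia.
  pose u := a A0 color0.
  apply: leq_trans (deg_le u _); last by rewrite eq_sym anv // eq_sym.
  apply/subset_leq_card/subsetP => A AX; rewrite inE AX /=.
  suff <- : a A color0 = u by exact: aA.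
  apply: (emb_vertex emb A0X (emb_cover _ emb AX)); first exact: ca.
  have [p gpA] := gp A AX; rewrite gpA gp0 /quad /=; congr (ka _.1).
  apply: xi_inj; have := gpA color1; have := gp0 color1.
  by rewrite -cv1 !av // cv1 /quad /= => -> ->.
(* A leaf determines its centre; together with [v] this makes three common vertices, so linearity
   applies. *)
have leaf_inj A B : A \in X -> B \in X -> a A color1 = a B color1 -> A = B.
  move=> AX BX eq1; have eq0 : a A color0 = a B color0.
    apply: (emb_vertex emb BX (emb_cover _ emb AX)); first exact: ca.
    have [p gpA] := gp A AX; have [q gqB] := gp B BX.
    rewrite gpA gqB /quad /=; congr (ka _.1); apply: xi_inj.
    by have := gpA color1; rewrite eq1 gqB.
  apply: (lin A B v (a A color0) (a A color1)) => //; rewrite ?vH ?aA //.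
  - apply: (@map_uniq _ _ c); rewrite /= !ca // !inE negb_or.
    by rewrite ncv0 ncv1.
  - by rewrite eq0 aA.
  - by rewrite eq1 aA.
(* Here [v] has colour 2 or 3, and [o] is the other of these two colours. *)
pose o := if c v == color2 then color3 else color2.
have colors i : [|| i == c v, i == color0, i == color1 | i == o].
  by rewrite /o; move: ncv0 ncv1; elim/ord4P: (c v); elim/ord4P: i.
pose X1 := [set A in X | (a A color0 \in W) || (a A color1 \in W)].
pose X2 := [set A in X | a A o \in W].
have X12 : #|X| <= #|X1| + #|X2|.
  rewrite (leq_trans _ (leq_card_setU X1 X2)) //.
  apply/subset_leq_card/subsetP => A AX; rewrite !inE AX /=.
  have [u uW uA] := Wcov A AX; have := colors (c u).
  rewrite (xA _ AX _ uA) in uW; case/or4P => /eqP Ec; rewrite Ec in uW.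
  - by rewrite av // (negPf vW) in uW.
  - by rewrite uW.
  - by rewrite uW orbT.
  - by rewrite uW !orbT.
(* A leaf in [W] accounts for at most one edge, a centre in [W] for at most one edge per leaf of its
   star. *)
have cX1 : #|X1| <= #|W| * y.
  apply: (leq_bigcup_card
    (P := fun u A => (a A color0 == u) || (a A color1 == u))) => [A|u _].
    rewrite inE => /andP[_ /orP[]]; first by exists (a A color0); rewrite ?eqxx.
    by exists (a A color1); rewrite ?eqxx ?orbT.
  have [cu1|ncu1] := eqVneq (c u) color1.
    apply: leq_trans y_gt0; apply/card_le1_eqP => A B.
    rewrite !inE => /andP[/andP[AX _] Au] /andP[/andP[BX _] Bu].
    have au C : C \in X -> (a C color0 == u) || (a C color1 == u) -> a C color1 = u.
      by move=> CX /orP[|/eqP //] /eqP au; move: cu1; rewrite -au ca.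
    exact: (leaf_inj _ _ BX AX (etrans (au _ BX Bu) (esym (au _ AX Au)))).
  have au C : C \in X -> (a C color0 == u) || (a C color1 == u) -> a C color0 = u.
    by move=> CX /orP[/eqP //|] /eqP au; move: ncu1; rewrite -au ca ?eqxx.
  set D := [set _ in _ | _].
  have [->|[B]] := set_0Vmem D; first by rewrite cards0.
  rewrite !inE => /andP[/andP[BX _] /(au _ BX) Bu]; have [q gqB] := gp B BX.
  apply: leq_trans (c_leaves q.1.1).
  apply: (card_le_inj (f := fun A => a A color1)) => [A C|A].
    rewrite !inE => /andP[/andP[AX _] _] /andP[/andP[CX _] _].
    exact: leaf_inj.
  rewrite !inE => /andP[/andP[AX _] /(au _ AX) Au].
  by apply: center; rewrite // Au -Bu gqB.
(* The cover of [X2] consists of [v], vertices of [W], at most [x] centres and at most [#|X2|]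
   leaves, so sparsity gives [11 * #|X2| <= 10 * (1 + w + x + #|X2|)]. *)
have cX2 : #|X2| <= 10 * (1 + w + x).
  have [->//|X2_gt0] := posnP #|X2|.
  have X2X : X2 \subset X by apply/subsetP => A; rewrite inE => /andP[].
  have := sparse X2 X2X X2_gt0.
  pose C0 := [set vert color0 (ka i) | i : 'I_x].
  have cC0 : #|C0| <= x by rewrite (leq_trans (leq_imset_card _ _)) // card_ord.
  pose C1 := [set a A color1 | A in X2].
  have cC1 : #|C1| <= #|X2| by exact: leq_imset_card.
  suff /subset_leq_card : cover X2 \subset v |: (W :|: (C0 :|: C1)).
    have := (leq_card_setU [set v] (W :|: (C0 :|: C1))).1.
    have := (leq_card_setU W (C0 :|: C1)).1.
    have := (leq_card_setU C0 C1).1.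
    by rewrite cards1; lia.
  apply/subsetP => u /bigcupP[A AX2 uA].
  have /andP[AX aW] : (A \in X) && (a A o \in W) by move: AX2; rewrite inE.
  rewrite (xA _ AX _ uA) 3!inE [in X in _ || X]inE.
  case/or4P: (colors (c u)) => /eqP ->.
  - by rewrite av ?eqxx.
  - have [p gpA] := gp A AX; apply/or4P/Or43/imsetP; exists p.1.1 => //.
    by rewrite {1}(vertex_atE v color0 emb AX) gpA.
  - by apply/or4P/Or44/imsetP; exists A.
  - by rewrite aW orbT.
by nia.
Qed.

(** * Numerical forms of sparsity *)

(** Each of n - 1, n - 2, n - 3 is at least n / 2, and 192 = 24 * 8. *)
Lemma bin4_ge (n : nat) : 6 <= n -> n ^ 4 <= 192 * 'C(n, 4).
Proof.
move=> le6n; have := bin_ffact n 4.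
rewrite !ffactnS ffactn0 (_ : 4`! = 24) // => E.
have -> : 192 * 'C(n, 4) = 8 * ('C(n, 4) * 24) by lia.
rewrite {}E; have -> : n ^ 4 = n * (n * (n * n)) by ring.
have -> : 8 * (n * (n.-1 * (n.-1.-1 * (n.-1.-1.-1 * 1))))
        = n * ((2 * n.-1) * ((2 * n.-1.-1) * (2 * n.-1.-1.-1))) by ring.
by apply: leq_mul => //; apply: leq_mul; [lia|apply: leq_mul; lia].
Qed.

Lemma sparse_exponents (n e w m : nat) :
  6 <= n -> 'C(n, 4) ^ m <= n ^ w * e ^ m ->
  n ^ (4 * m) <= n ^ w * (192 * e) ^ m.
Proof.
move=> le6n le_m; rewrite expnM.
apply: (@leq_trans ((192 * 'C(n, 4)) ^ m)).
  by case: m {le_m} => // m; rewrite leq_exp2r ?bin4_ge.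
rewrite !expnMn mulnCA; exact: leq_mul.
Qed.

(** Since 192 e is at most n^3 / 2, assuming [w <= m] would give 2^m n^(4m) <= n^(4m). *)
Lemma sparse_cubic (n e w m : nat) :
  6 <= n -> 384 * e <= n ^ 3 -> 0 < m ->
  'C(n, 4) ^ m <= n ^ w * e ^ m -> m < w.
Proof.
move=> le6n le_e m_gt0 /(sparse_exponents le6n) le_m.
rewrite ltnNge; apply/negP => le_wm.
have n_gt0 k : 0 < n ^ k by rewrite expn_gt0; lia.
have : 2 ^ m * n ^ (4 * m) <= n ^ m * n ^ (3 * m).
  apply: (@leq_trans (2 ^ m * (n ^ m * (192 * e) ^ m))).
    rewrite leq_mul2l; apply/orP; right; apply: leq_trans le_m _.
    by rewrite leq_mul2r leq_pexp2l ?orbT; lia.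
  rewrite mulnCA -expnMn leq_mul2l expnM leq_exp2r //.
  by apply/orP; right; apply: leq_trans le_e; lia.
rewrite -expnD (_ : m + 3 * m = 4 * m); last lia.
rewrite -{2}[n ^ (4 * m)]mul1n leq_pmul2r //.
by rewrite leqNgt -{1}(expn0 2) ltn_exp2l ?m_gt0.
Qed.

(** Here 192 <= n^(1/10) and e <= n^(14/5), so 192 e <= n^(29/10); compare the exponents 4m and w +
    29m/10. *)
Lemma sparse_subcubic (n e w m : nat) :
  6 <= n -> 192 ^ 10 <= n -> e ^ 5 <= n ^ 14 -> 0 < m ->
  'C(n, 4) ^ m <= n ^ w * e ^ m -> 11 * m <= 10 * w.
Proof.
move: (192 ^ 10) (expnM 192 10 m) => K EK le6n leK le_e m_gt0.
move=> /(sparse_exponents le6n) le_m.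
rewrite -(@leq_exp2l n); last lia.
have n_gt0 k : 0 < n ^ k by rewrite expn_gt0; lia.
rewrite -(leq_pmul2r (n_gt0 (29 * m))).
have -> : n ^ (11 * m) * n ^ (29 * m) = (n ^ (4 * m)) ^ 10.
  by rewrite -expnD -expnM; congr (_ ^ _); lia.
apply: (@leq_trans ((n ^ w * (192 * e) ^ m) ^ 10)); first by rewrite leq_exp2r.
rewrite expnMn -!expnM expnMn [w * 10]mulnC leq_mul2l; apply/orP; right.
rewrite (_ : 29 * m = m + 14 * (2 * m)); last lia.
rewrite expnD.
apply: leq_mul.
  by rewrite mulnC EK leq_exp2r.
rewrite (_ : m * 10 = 5 * (2 * m)); last lia.
by rewrite (expnM e 5) (expnM n 14) leq_exp2r //; lia.
Qed.

(** * Choice of the parameters and the two bounds in integer form *)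

Lemma ex_power2 (b : nat) : 0 < b -> exists2 k, 2 ^ k <= b & b < 2 ^ k.+1.
Proof.
move=> b_gt0; exists (trunc_log 2 b);
  by have /andP[] := trunc_log_bounds (isT : 1 < 2) b_gt0.
Qed.

Lemma ex_root (f e j : nat) : 0 < f -> 0 < j ->
  exists r, [/\ 0 < r, e <= r ^ j * f & r = 1 \/ r ^ j * f <= 2 ^ j * e].
Proof.
move=> f_gt0 j_gt0.
have ex_r : exists r, (0 < r) && (e <= r ^ j * f).
  exists e.+1; rewrite /= (leq_trans _ (leq_pmulr _ f_gt0)) //.
  by rewrite (leq_trans (leqnSn e)) // -{1}(expn1 e.+1) leq_pexp2l.
case: (ex_minnP ex_r) => r /andP[r_gt0 le_e] min_r; exists r; split=> //.
have [->|r_neq1] := eqVneq r 1; [by left|right].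
have : ~~ (e <= r.-1 ^ j * f).
  apply/negP => le_e'.
  by have := min_r r.-1 ltac:(by rewrite le_e' andbT; lia); lia.
rewrite -ltnNge => /ltnW lt_e; apply: leq_trans (leq_mul (leqnn _) lt_e).
by rewrite mulnA -expnMn leq_mul2r leq_exp2r // orbC; lia.
Qed.

Lemma unavoidable_setup (n e : nat) (H : kgraph 4) :
  64 * 64 <= n -> n ^ 2 <= e -> 512 * e <= n ^ 3 -> unavoidable n e H ->
  0 < #|edges H| ->
  [/\ e <= 'C(n, 4), linear_family (edges H) &
      exists v : vertex H, forall A, A \in edges H -> v \in A].
Proof.
move=> len le_ne le_en unH /card_gt0P[A AX].
have [v0 _] : exists v0 : vertex H, true.
  have /card_gt0P[v0 _] : 0 < #|A| by rewrite (edges_uniform AX).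
  by exists v0.
have e_gt0 : 0 < e by rewrite (leq_trans _ le_ne) // expn_gt0; lia.
have lem : 4 * (n %/ 4) <= n by lia.
have le_em : 0 < e <= (n %/ 4) ^ 3.
  rewrite e_gt0 -(@leq_pmul2l 512) // (leq_trans le_en) //.
  rewrite (_ : 512 = 8 ^ 3) // -expnMn leq_exp2r //; lia.
split.
- rewrite -(@leq_pmul2l 192) // (leq_trans _ (bin4_ge _)) //; last lia.
  rewrite expnS (leq_trans _ (leq_mul (leqnn n) le_en)) // mulnA.
  by rewrite leq_mul2r; lia.
- exact: unavoidable_linear v0 unH lem le_em.
- exact: unavoidable_star v0 unH lem le_em.
Qed.

Lemma unavoidable_cube_bound (n e : nat) (H : kgraph 4) :
  64 * 64 <= n -> n ^ 2 <= e -> 512 * e <= n ^ 3 -> unavoidable n e H ->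
  #|edges H| ^ 3 * n <= 16 ^ 3 * e.
Proof.
move=> len le_ne le_en unH.
have [->|h_gt0] := posnP #|edges H|; first by rewrite mul0n.
have [leM _ [v vH]] := unavoidable_setup len le_ne le_en unH h_gt0.
have n_gt0 : 0 < n by lia.
have e_gt0 : 0 < e by rewrite (leq_trans _ le_ne) // expn_gt0 n_gt0.
have lt_hw : #|edges H| < #|cover (edges H)|.
  apply: (sparse_cubic (n := n) (e := e)) => //; [lia|lia|].
  exact: unavoidable_sparse.
(* The factor 8 pays for rounding: the number of blocks [n %/ (4 * a)] is at least n / (8 a). *)
have [a [a_gt0 le_e a_ub]] := ex_root (8 * e) n_gt0 (isT : 0 < 3).
have {}a_ub : a ^ 3 * n <= 64 * e.
  case: a_ub => [->|]; last lia.
  by rewrite mul1n (leq_trans _ (leq_pmull e _)) // (leq_trans _ le_ne) //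
    leq_pmulr.
have le4a : 4 * a <= n.
  rewrite -(@leq_exp2r _ _ 3) // -(leq_pmul2r n_gt0) expnMn -mulnA.
  apply: leq_trans (leq_mul (leqnn _) a_ub) _.
  rewrite (mulnC (n ^ 3)) (leq_trans _ (leq_mul len le_en)) //; lia.
have b_ge : n <= 8 * (a * (n %/ (4 * a))).
  have a4_gt0 : 0 < 4 * a by rewrite muln_gt0.
  have b_gt0 : 0 < n %/ (4 * a) by rewrite divn_gt0.
  move: (ltn_ceil n a4_gt0) b_gt0; move: (n %/ (4 * a)) => b; clear; nia.
have le_w : #|cover (edges H)| <= 4 * a.
  apply: (unavoidable_connected (s := n %/ (4 * a)) unH vH).
    by rewrite mulnA mulnC leq_trunc_div.
  rewrite e_gt0 -(@leq_pmul2l 8) // (leq_trans le_e) //.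
  have -> : 8 * (n %/ (4 * a) * a ^ 4) = a ^ 3 * (8 * (a * (n %/ (4 * a)))) by ring.
  by rewrite leq_mul2l b_ge orbT.
have le_h : #|edges H| <= 4 * a by lia.
apply: (@leq_trans ((4 * a) ^ 3 * n)).
  by rewrite leq_mul2r leq_exp2r ?le_h ?orbT.
have -> : 16 ^ 3 * e = 4 ^ 3 * (64 * e) by ring.
by rewrite expnMn -mulnA leq_mul2l a_ub orbT.
Qed.

Lemma unavoidable_fourth_bound (n e : nat) (H : kgraph 4) :
  192 ^ 10 <= n -> 64 * 64 <= n -> n ^ 2 <= e ->
  32 * (32 * 32) * e <= n ^ 3 -> e ^ 5 <= n ^ 14 -> unavoidable n e H ->
  exists r, r ^ 4 * n ^ 2 <= 16 * e /\ #|edges H| <= 858 * r ^ 3.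
Proof.
move=> leK len le_ne le_en e5 unH.
have n_gt0 : 0 < n by lia.
have n2_gt0 : 0 < n ^ 2 by rewrite expn_gt0 n_gt0.
have e_gt0 : 0 < e by rewrite (leq_trans _ le_ne).
have [r [r_gt0 le_e r_ub]] := ex_root e n2_gt0 (isT : 0 < 4).
have {}r_ub : r ^ 4 * n ^ 2 <= 16 * e.
  by case: r_ub => [->|//]; rewrite mul1n (leq_trans le_ne) // leq_pmull.
exists r; split=> //.
have [->//|h_gt0] := posnP #|edges H|.
have [|leM lin [v vH]] := unavoidable_setup len le_ne _ unH h_gt0; first lia.
(* From [32 * (32 * 32) = 16 * (32 * 64)]; this is the room that the hosts below need. *)
have le_rn : 32 * 64 * r ^ 4 <= n.
  rewrite -(leq_pmul2r n2_gt0) -expnS -mulnA.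
  by apply: leq_trans (leq_mul (leqnn _) r_ub) _; lia.
set m := n %/ 4; have lem : 4 * m <= n by lia.
have lenm : n <= 8 * m by lia.
have le_em : e <= 64 * r ^ 4 * m ^ 2.
  apply: leq_trans le_e _; rewrite [64 * _]mulnC -mulnA leq_mul2l.
  by rewrite (_ : 64 = 8 ^ 2) // -expnMn leq_exp2r // lenm orbT.
have le_r24 : r ^ 2 <= r ^ 4 by rewrite leq_pexp2l.
have [W [vW cW Wcov]] : exists W : {set vertex H}, [/\ v \notin W,
    #|W| <= 2 * (8 * r ^ 2) &
    forall A, A \in edges H -> exists2 w, w \in W & w \in A].
  apply: (unavoidable_cover (m := m) v unH lem); first lia.
  by rewrite e_gt0 (leq_trans le_em) // expnMn -expnM.
have s_gt0 : 0 < 8 * r ^ 2 by rewrite muln_gt0 expn_gt0 r_gt0.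
(* A field of order a power of two is within a factor 2 of the largest order that fits. *)
have [k k_lb k_ub] : exists2 k, 2 ^ k <= n %/ (4 * (8 * r ^ 2)) &
    n %/ (4 * (8 * r ^ 2)) < 2 ^ k.+1.
  by apply: ex_power2; rewrite divn_gt0; lia.
have k_gt0 : 0 < k.
  case: k k_ub {k_lb} => //; rewrite expn1 ltnS => le1.
  by have := @leq_divRL 2 n (4 * (8 * r ^ 2)); lia.
have [F _ cF] := pPrimePowerField (isT : prime 2) k_gt0.
have q_ub : 4 * (#|F| * (8 * r ^ 2)) <= n.
  by rewrite cF mulnCA mulnC; move: k_lb; rewrite leq_divRL; lia.
have q_lb : n < #|F| * (64 * r ^ 2).
  by move: k_ub; rewrite ltn_divLR ?expnS -?cF; lia.
have le_sq : 4 * (8 * r ^ 2) <= #|F|.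
  have r4 : r ^ 4 = r ^ 2 * r ^ 2 by rewrite -expnD.
  have r2_gt0 : 0 < r ^ 2 by rewrite expn_gt0 r_gt0.
  rewrite r4 in le_rn; move: (r ^ 2) #|F| r2_gt0 le_rn q_lb => t q; clear; nia.
have degv u : v != u -> pair_degree (edges H) v u <= 32 * r ^ 2.
  move=> nvu; rewrite (_ : 32 * r ^ 2 = 4 * (8 * r ^ 2)); last lia.
  apply: (unavoidable_pair_degree unH lin q_ub) => //.
  rewrite e_gt0 (leq_trans le_e) //.
  have -> : #|F| ^ 2 * (8 * r ^ 2) ^ 4 = r ^ 4 * (#|F| * (64 * r ^ 2)) ^ 2.
    by ring.
  by rewrite leq_mul2l leq_exp2r // (ltnW q_lb) orbT.
have := unavoidable_stars (n := n) (e := e) (x := 64 * r ^ 3) (y := r)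
  (m := m) (d := 32 * r ^ 2) (w := 16 * r ^ 2) unH lem.
have -> : 64 * r ^ 3 * r = 64 * r ^ 4 by ring.
have le64 : 64 * r ^ 4 <= m by lia.
move=> /(_ v W le64); rewrite e_gt0 le_em => /(_ isT vH lin degv vW).
have -> : #|W| <= 16 * r ^ 2 by lia.
move=> /(_ isT Wcov) bound; apply: leq_trans (bound _) _ => [Y YX Y_gt0|].
  by apply: sparse_subcubic e5 Y_gt0 _; [lia|done|exact: unavoidable_sparse].
(* The constant is 858 = 32 + 16 + 10 * (1 + 16 + 64). *)
have le_r23 : r ^ 2 <= r ^ 3 by rewrite leq_pexp2l.
have r3_gt0 : 0 < r ^ 3 by rewrite expn_gt0 r_gt0.
have -> : r * (32 * r ^ 2) + 16 * r ^ 2 * r = 48 * r ^ 3 by ring.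
lia.
Qed.

(** The conclusion is h <= c t^3 (e / n^2)^(3/4), cleared of roots. *)
Lemma fourth_bound_small (h n e r c t : nat) :
  r ^ 4 * n ^ 2 <= t ^ 4 * e -> h <= c * r ^ 3 ->
  h ^ 4 * n ^ 6 <= (c * t ^ 3) ^ 4 * e ^ 3.
Proof.
move=> r_ub h_ub; apply: (@leq_trans ((c * r ^ 3) ^ 4 * n ^ 6)).
  by rewrite leq_mul2r leq_exp2r // h_ub orbT.
have -> : (c * r ^ 3) ^ 4 * n ^ 6 = c ^ 4 * (r ^ 4 * n ^ 2) ^ 3 by ring.
have -> : (c * t ^ 3) ^ 4 * e ^ 3 = c ^ 4 * (t ^ 4 * e) ^ 3 by ring.
by rewrite leq_mul2l leq_exp2r // r_ub orbT.
Qed.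

(* At e ^ 5 = n ^ 14 the two bounds of the theorem cross. *)
Lemma fourth_bound_large (h n e t : nat) :
  0 < n -> h ^ 3 * n <= t ^ 3 * e -> n ^ 14 <= e ^ 5 ->
  h ^ 4 * n ^ 6 <= t ^ 4 * e ^ 3.
Proof.
move=> n_gt0 cube e5; have n4_gt0 : 0 < n ^ 4 by rewrite expn_gt0 n_gt0.
rewrite -(@leq_exp2r _ _ 3) // -(leq_pmul2r n4_gt0).
have -> : (h ^ 4 * n ^ 6) ^ 3 * n ^ 4 = (h ^ 3 * n) ^ 4 * (n ^ 14 * n ^ 4) by ring.
have -> : (t ^ 4 * e ^ 3) ^ 3 * n ^ 4 = (t ^ 3 * e) ^ 4 * (e ^ 5 * n ^ 4) by ring.
by apply: leq_mul; rewrite ?leq_exp2r // leq_mul2r e5 orbT.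
Qed.

Lemma unavoidable_bounds (n e : nat) (H : kgraph 4) :
  192 ^ 10 <= n -> 64 * 64 <= n -> n ^ 2 <= e ->
  32 * (32 * 32) * e <= n ^ 3 -> unavoidable n e H ->
  #|edges H| ^ 3 * n <= (858 * 2 ^ 3) ^ 3 * e /\
  #|edges H| ^ 4 * n ^ 6 <= (858 * 2 ^ 3) ^ 4 * e ^ 3.
Proof.
move=> leK len le_ne le_en unH; have n_gt0 : 0 < n by lia.
have cube : #|edges H| ^ 3 * n <= (858 * 2 ^ 3) ^ 3 * e.
  apply: leq_trans (unavoidable_cube_bound len le_ne _ unH) _; first lia.
  by rewrite leq_mul2r leq_exp2r // orbT.
split=> //; have [e5|/ltnW e5] := leqP (e ^ 5) (n ^ 14).
  have [r [r_ub h_ub]] := unavoidable_fourth_bound leK len le_ne le_en e5 unH.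
  by apply: fourth_bound_small h_ub; rewrite (_ : 2 ^ 4 = 16).
exact: fourth_bound_large n_gt0 cube e5.
Qed.

(* Passage to real powers *)
From mathcomp Require Import all_classical all_reals exp.
Import Order.TTheory GRing.Theory Num.Theory.
Local Open Scope ring_scope.

Lemma le_powR_ratio (R : realType) (x y : R) (i j : nat) :
  0 <= x -> 0 <= y -> x ^+ j.+1 <= y ^+ i -> x <= y `^ (i%:R / j.+1%:R).
Proof.
move=> x0 y0 le_xy; rewrite powRrM powR_mulrn //.
have -> : x = (x ^+ j.+1) `^ (j.+1%:R^-1).
  by rewrite -powR_mulrn // -powRrM mulfV ?powRr1 // pnatr_eq0.
by apply: ge0_ler_powR; rewrite ?nnegrE ?invr_ge0 ?exprn_ge0.
Qed.

Theorem theorem4p2 (R : realType) :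
  exists C0 c0 D : R,
    [/\ 0 < C0, 0 < c0, 0 < D &
      exists N : nat, forall n e : nat,
        (N <= n)%N ->
        C0 * n%:R ^+ 2 <= e%:R -> e%:R <= c0 * n%:R ^+ 3 ->
        (un 4 n e)%:R <=
          D * Num.min ((e%:R / n%:R ^+ 2) `^ (3 / 4)) ((e%:R / n%:R) `^ (1 / 3))].
Proof.
(* In [858 * 2 ^+ 3], 858 comes from [858 * r ^ 3] and 2 from r <= 2 (e / n^2)^(1/4). *)
exists 1, (32 * (32 * 32))^-1, (858 * 2 ^+ 3); split.
- exact: ltr01.
- by rewrite invr_gt0 !mulr_gt0 ?ltr0n.
- by rewrite mulr_gt0 ?exprn_gt0 ?ltr0n.
have [N [leKN leN]] : exists N, (192 ^ 10 <= N)%N /\ (64 * 64 <= N)%N.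
  by exists (192 ^ 10 + 64 * 64)%N; split; [exact: leq_addr|exact: leq_addl].
exists N => n e leNn; rewrite mul1r => le_neR le_enR.
have le_ne : (n ^ 2 <= e)%N by rewrite -(ler_nat R) natrX.
have le_en : (32 * (32 * 32) * e <= n ^ 3)%N.
  rewrite -(ler_nat R) natrX !natrM -ler_pdivlMl //.
  by rewrite !mulr_gt0 ?ltr0n.
have leK := leq_trans leKN leNn; have len := leq_trans leN leNn.
have bounds := unavoidable_bounds leK len le_ne le_en.
clear leK leKN; have n_gt0 : (0 < n)%N by exact: leq_trans len.
(* In this range [un 4 n e] is an attained maximum and not the default 0. *)
have leM : (e <= 'C(n, 4))%N.
  rewrite -(@leq_pmul2l 192) // (leq_trans _ (bin4_ge _)) //;
    last exact: leq_trans len.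
  rewrite expnS (leq_trans _ (leq_mul (leqnn n) le_en)) // mulnA.
  by rewrite leq_mul2r; lia.
have [[H unH hE] _] := unP leM.
have [] := bounds _ unH.
rewrite hE; move: (un 4 n e) => h cube fourth.
have nR_gt0 : (0 : R) < n%:R by rewrite ltr0n.
have D_gt0 : (0 : R) < 858 * 2 ^+ 3 by rewrite mulr_gt0 ?exprn_gt0 ?ltr0n.
have hD_ge0 : (0 : R) <= h%:R / (858 * 2 ^+ 3) by rewrite divr_ge0 // ltW.
rewrite -ler_pdivrMl // mulrC le_min; apply/andP; split.
  apply: (@le_powR_ratio _ _ _ 3 3) => //; first by rewrite divr_ge0 ?exprn_ge0.
  rewrite !expr_div_n -exprM (_ : (2 * 3)%N = 6) // ler_pdivrMr ?exprn_gt0 //.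
  rewrite mulrAC ler_pdivlMr ?exprn_gt0 // [leRHS]mulrC.
  by rewrite -!natrX -!natrM -!natrX -!natrM ler_nat.
apply: (@le_powR_ratio _ _ _ 1 2) => //; first by rewrite divr_ge0.
rewrite expr1 expr_div_n ler_pdivrMr ?exprn_gt0 //.
rewrite mulrAC ler_pdivlMr // [leRHS]mulrC.
by rewrite -!natrX -!natrM -!natrX -!natrM ler_nat.
Qed.
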